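(* There is an absolute constant $c>0$ such that the following holds. Let $n\ge 7$ be an integer, let $\theta\in(0,\pi)$, put $\delta=\cos\theta$, and suppose that the set $\{s\ge 1: x_s\le \delta-2n^{-1/2}\}$ is non-empty, where $x_s$ denotes the maximal root of $P_s$. Let $$r:=\max\left\{s\ge 1~:~x_s\le \delta-2n^{-1/2}\right\}.$$ Then $$M_{LP}(n,\theta)\ \ge\ \frac{c}{r\,n^{1/2}}\left(\frac{1}{1-\delta^2}\right)^{\frac{n-4}{4}}\frac{P_r(1)}{\|P_r\|_2}.$$
   Context: For an integer $n\ge 3$ let $w(t)=(1-t^2)^{\frac{n-3}{2}}$ on $(-1,1)$, and let $P_s=P_s^{\frac{n-3}{2},\frac{n-3}{2}}$ ($s=0,1,2,\dots$) be the Jacobi polynomials of degree $s$, orthogonal on $(-1,1)$ with respect to the weight $w$, with the standard (Szegő) normalization $P_s(1)=\binom{s+\frac{n-3}{2}}{s}$, so $P_0\equiv 1$. The norm is $\|P_s\|_2^2=\int_{-1}^1 P_s(t)^2w(t)\,dt$. For $s\ge1$, $x_s$ is the largest root of $P_s$. Delsarte's linear programming bound for spherical codes in dimension $n$ with angular distance $\theta$ is $$M_{LP}(n,\theta)=\inf\Big\{F(1):\ F=\sum_{s=0}^m a_sP_s,\ a_0=1,\ a_s\ge 0 \text{ for all } s,\ F\le 0\text{ on }[-1,\cos\theta]\Big\},$$ where the degree $m$ may be arbitrarily large. *)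

(* Defs.v *)
From HB Require Import structures.
From mathcomp Require Import all_boot all_order all_algebra.
From mathcomp Require Import all_classical all_reals all_analysis.

Set Implicit Arguments.
Unset Strict Implicit.
Unset Printing Implicit Defensive.

Import Order.TTheory GRing.Theory Num.Theory.
Local Open Scope classical_set_scope.
Local Open Scope ring_scope.

Definition is_max {d} {T : porderType d} (A : set T) (m : T) : Prop :=
  A m /\ ubound A m.

Definition gbinom {R : realType} (x : R) (k : nat) : R :=
  (\prod_(i < k) (x - i%:R)) / k`!%:R.

(* alpha n = (n-3)/2 may be a half-integer, hence the real power. *)
Definition alpha {R : realType} (n : nat) : R := (n%:R - 3) / 2.

Definition weight {R : realType} (n : nat) (t : R) : R :=
  (1 - t ^+ 2) `^ alpha n.

Definition wdot {R : realType} (n : nat) (p q : {poly R}) : R :=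
  Rintegral (@lebesgue_measure R) `]-1, 1[%classic
    (fun t => p.[t] * q.[t] * weight n t).

Definition wnorm {R : realType} (n : nat) (p : {poly R}) : R :=
  Num.sqrt (wdot n p p).

(* The three conditions determine P uniquely: s |-> P_s^{alpha,alpha} in
   Szego's normalization. *)
Definition jacobi_family {R : realType} (n : nat) (P : nat -> {poly R}) : Prop :=
  [/\ forall s, size (P s) = s.+1,
      forall s k, s <> k -> wdot n (P s) (P k) = 0
    & forall s, (P s).[1] = gbinom (s%:R + alpha n) s].

Definition LP_feasible {R : realType} (P : nat -> {poly R}) (theta : R)
    (F : {poly R}) : Prop :=
  exists (m : nat) (a : nat -> R),
    [/\ F = \sum_(s < m.+1) a s *: P s,
        a 0%N = 1,
        forall s, (s <= m)%N -> 0 <= a s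
      & forall t, -1 <= t <= cos theta -> F.[t] <= 0].

(* Extended-real valued, so that the infimum of the empty set would be +oo. *)
Definition M_LP {R : realType} (P : nat -> {poly R}) (theta : R) : \bar R :=
  ereal_inf [set (F.[1])%:E | F in [set F | LP_feasible P theta F]].

Definition root_index_set {R : realType} (P : nat -> {poly R}) (d : R) :
    set nat :=
  [set s | (1 <= s)%N /\
           exists2 x : R, is_max [set t | root (P s) t] x & x <= d].

(* Main.v *)
(* Duality for the linear program: if a positive measure nu on [-1, delta] has
   total mass H and K * int P_s dnu >= - P_s(1) for all s >= 1, then integrating a
   feasible F against nu gives F(1) >= K * H.  We take
     nu = w 1_[-1, delta] + 2 r w(delta) 1_[delta - eta, delta],
   with eta = 1 / (r sqrt n).  Up to terms orthogonal to P_s, nu is minus the tail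
   of w beyond delta plus a bump just left of delta.  For s <= r the polynomial
   P_s is positive and slowly varying on the bump, and the differential equation
   evaluates its tail integral as a boundary term that the bump outweighs, so
   int P_s dnu >= 0.  For s > r Cauchy-Schwarz bounds |int P_s dnu| by
   3 r sqrt(w(delta)) ||P_s||_2, and P_s(1) / ||P_s||_2 is nondecreasing in s by
   the three-term recurrence, so K = P_r(1) / (3 r sqrt(w(delta)) ||P_r||_2) is
   admissible; the mass is at least 3 / (8 sqrt n). *)
Require Import Defs.
From HB Require Import structures.
From mathcomp Require Import all_boot all_order all_algebra.
From mathcomp Require Import all_classical all_reals all_analysis.
From mathcomp Require Import ring lra zify.

Set Implicit Arguments.
Unset Strict Implicit.
Unset Printing Implicit Defensive.

Import Order.TTheory GRing.Theory Num.Theory.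
Import numFieldNormedType.Exports.
Local Open Scope classical_set_scope.
Local Open Scope ring_scope.


(** * Integrals of continuous functions over compact intervals *)

Definition itv_int {R : realType} (f : R -> R) (a b : R) : R :=
  Rintegral (@lebesgue_measure R) `[a, b]%classic f.

Section IntervalIntegral.
Context {R : realType}.
Implicit Types (f g F : R -> R) (a b c k : R).

Lemma itv_integrable f a b : {within `[a, b], continuous f} ->
  (@lebesgue_measure R).-integrable `[a, b] (EFin \o f).
Proof.
move=> cf; apply: continuous_compact_integrable => //.
exact: segment_compact.
Qed.

Lemma within_continuousM (A : set R) f g :
  {within A, continuous f} -> {within A, continuous g} ->
  {within A, continuous (fun x => f x * g x)}.
Proof.
by move=> cf cg x; apply: cvgM; [exact: cf|exact: cg].
Qed.

Lemma itv_intD f g a b :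
  {within `[a, b], continuous f} -> {within `[a, b], continuous g} ->
  itv_int (fun x => f x + g x) a b = itv_int f a b + itv_int g a b.
Proof. by move=> cf cg; apply: RintegralD => //; exact: itv_integrable. Qed.

Lemma itv_intZ k f a b : {within `[a, b], continuous f} ->
  itv_int (fun x => k * f x) a b = k * itv_int f a b.
Proof. by move=> cf; apply: RintegralZl => //; exact: itv_integrable. Qed.

Lemma itv_int_cst k a b : a <= b -> itv_int (fun=> k) a b = k * (b - a).
Proof.
move=> ab; rewrite /itv_int Rintegral_cst //= lebesgue_measure_itv /= lte_fin.
case: ltP => [_|ba] //.
by have -> : b = a; [apply/le_anti; rewrite ab ba|rewrite subrr].
Qed.

Lemma itv_int_le f g a b :
  {within `[a, b], continuous f} -> {within `[a, b], continuous g} ->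
  (forall x, a <= x <= b -> f x <= g x) -> itv_int f a b <= itv_int g a b.
Proof.
move=> cf cg fg; apply: le_Rintegral => //; exact: itv_integrable.
Qed.

Lemma eq_itv_int f g a b : (forall x, a <= x <= b -> f x = g x) ->
  itv_int f a b = itv_int g a b.
Proof.
move=> fg; apply: eq_Rintegral => x.
by rewrite inE /= in_itv /=; apply: fg.
Qed.

Lemma itv_int_split f a b c : a <= b -> b <= c ->
  {within `[a, c], continuous f} ->
  itv_int f a c = itv_int f a b + itv_int f b c.
Proof.
move=> ab bc cf.
have fi := itv_integrable cf.
rewrite /itv_int; rewrite [RHS]addrC; apply/eqP; rewrite -subr_eq; apply/eqP.
rewrite (Rintegral_itvB fi) ?bnd_simp //.
apply: Rintegral_itv_obnd_cbnd.
apply: integrableS fi => //.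
by apply: subset_itvr; rewrite bnd_simp.
Qed.

Lemma itv_int_ftc F f a b : a < b ->
  {within `[a, b], continuous F} -> {within `[a, b], continuous f} ->
  (forall x, a < x < b -> is_derive x 1 F (f x)) ->
  itv_int f a b = F b - F a.
Proof.
move=> ab cF cf dF; rewrite /itv_int /Rintegral (@continuous_FTC2 _ f F) //.
- have /continuous_within_itvP := cF.
  move=> /(_ ab) [_ Fa Fb]; split => // x.
  by rewrite in_itv /= => /dF [].
- move=> x; rewrite in_itv /= => /dF dFx.
  by rewrite derive1E derive_val.
Qed.

Lemma itv_int_ge0 f a b : (forall x, a <= x <= b -> 0 <= f x) ->
  0 <= itv_int f a b.
Proof. by move=> f0; apply: Rintegral_ge0 => x; rewrite /= in_itv; apply: f0. Qed.

Lemma itv_int_ge_sub f a b c d : a <= c -> c <= d -> d <= b ->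
  {within `[a, b], continuous f} -> (forall x, a <= x <= b -> 0 <= f x) ->
  itv_int f c d <= itv_int f a b.
Proof.
move=> ac cd db cf f0.
have cb := le_trans cd db.
rewrite (itv_int_split ac cb cf) (itv_int_split cd db); last first.
  by apply: continuous_subspaceW cf; apply: subset_itvr; rewrite bnd_simp.
have h1 : 0 <= itv_int f a c.
  by apply: itv_int_ge0 => x /andP[ax xc]; rewrite f0 // ax (le_trans xc).
have h2 : 0 <= itv_int f d b.
  apply: itv_int_ge0 => x /andP[dx xb]; rewrite f0 // xb andbT.
  exact: le_trans ac (le_trans cd dx).
lra.
Qed.

End IntervalIntegral.

(** * The weight, its inner product and the associated Sturm-Liouville operator *)

Section Weight.
Context {R : realType}.
Variable n : nat.
Hypothesis n_gt3 : (3 < n)%N.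
Implicit Types (p q : {poly R}) (s t : R).

Lemma alpha_gt0 : 0 < alpha n :> R.
Proof. by rewrite /alpha divr_gt0 // subr_gt0 ltr_nat. Qed.

(* Unlike the real power, the square root is visibly continuous at 0. *)
Lemma weightE t : 0 <= 1 - t ^+ 2 ->
  weight n t = Num.sqrt ((1 - t ^+ 2) ^+ (n - 3)).
Proof.
move=> t0; rewrite /weight -powR12_sqrt ?exprn_ge0 // -[X in _ = X `^ _]powR_mulrn //.
by rewrite -powRrM /alpha natrB // ltnW.
Qed.

Lemma oneB_sqr_ge0 t : -1 <= t <= 1 -> 0 <= 1 - t ^+ 2.
Proof. by move=> /andP[? ?]; nra. Qed.

Lemma oneB_sqr_gt0 t : -1 < t < 1 -> 0 < 1 - t ^+ 2.
Proof. by move=> /andP[? ?]; nra. Qed.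

Lemma weight_ge0 t : 0 <= weight n t.
Proof. exact: powR_ge0. Qed.

Lemma weight_gt0 t : -1 < t < 1 -> 0 < weight n t.
Proof. by move=> /oneB_sqr_gt0; exact: powR_gt0. Qed.

Lemma weight_nincr s t : 0 <= s -> s <= t -> t <= 1 -> weight n t <= weight n s.
Proof.
move=> s0 st t1; apply: ge0_ler_powR; rewrite ?nnegrE ?(ltW alpha_gt0) //; nra.
Qed.

Lemma weight_continuous : {within `[-1, 1], continuous (@weight R n)}.
Proof.
apply: (@subspace_eq_continuous _ _ _
  (fun t => Num.sqrt ((1 - 'X ^+ 2) ^+ (n - 3) : {poly R}).[t])).
  move=> t; rewrite inE /= in_itv /= => /oneB_sqr_ge0 t0.
  by apply: etrans (esym (weightE t0)); rewrite horner_exp !hornerE.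
apply: continuous_subspaceT => t.
pose h : R -> R := horner ((1 - 'X ^+ 2) ^+ (n - 3)).
apply: (@continuous_comp _ _ _ h (@Num.sqrt R)); first exact: continuous_horner.
exact: sqrt_continuous.
Qed.

Lemma weight_continuous_itv (a b : R) : -1 <= a -> b <= 1 ->
  {within `[a, b], continuous (@weight R n)}.
Proof.
move=> a1 b1; apply: continuous_subspaceW weight_continuous.
by apply: subset_itv; rewrite bnd_simp.
Qed.

Lemma poly_weight_continuous p (a b : R) : -1 <= a -> b <= 1 ->
  {within `[a, b], continuous (fun t => p.[t] * weight n t)}.
Proof.
move=> a1 b1; apply: within_continuousM; last exact: weight_continuous_itv.
exact/continuous_subspaceT/continuous_horner.
Qed.

(** The extra factor raises the exponent to [alpha n + 1], so the derivative is again a multiple of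
    the weight, and [2 * (alpha n + 1) = n - 1]. *)
Lemma is_derive_weight t : -1 < t < 1 ->
  is_derive t 1 (fun x => (1 - x ^+ 2) * weight n x)
            (- (n%:R - 1) * t * weight n t).
Proof.
move=> /oneB_sqr_gt0 t0.
have dp : is_derive t (1 : R) (fun x => 1 - x ^+ 2) (- 2 * t).
  have := is_derive_poly (1 - 'X ^+ 2) t.
  rewrite derivB derivXn -polyC1 derivC !hornerE.
  have -> : horner (1%:P - 'X ^+ 2) = (fun x : R => 1 - x ^+ 2).
    by apply/funext => x; rewrite !hornerE.
  by move=> h; apply: is_derive_eq h _; ring.
have dw : is_derive t (1 : R) (@weight R n)
    (alpha n * (1 - t ^+ 2) `^ (alpha n - 1) * (- 2 * t)).
  apply: (@is_derive1_comp R (fun x => x `^ alpha n) (fun x => 1 - x ^+ 2)).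
  exact: is_derive1_powR.
have := is_deriveM dp dw.
move=> h; apply: is_derive_eq h _.
rewrite /GRing.scale /=.
have -> : weight n t = (1 - t ^+ 2) `^ (alpha n - 1) * (1 - t ^+ 2).
  rewrite -[X in _ * X]powRr1 ?(ltW t0) // -powRD ?(gt_eqF t0) ?implybT //.
  by rewrite subrK.
by rewrite /alpha; field.
Qed.

(** With w the weight, [sl_op q] is ((1 - t^2) w q)' / w. Applied to p' it is the Gegenbauer
    operator (1 - t^2) p'' - (n - 1) t p'. *)
Definition sl_op q : {poly R} :=
  (1 - 'X ^+ 2) * q^`() - (n%:R - 1) *: ('X * q).

Lemma is_derive_flux q t : -1 < t < 1 ->
  is_derive t 1 (fun x => (1 - x ^+ 2) * weight n x * q.[x])
            ((sl_op q).[t] * weight n t).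
Proof.
move=> t1; have h := is_deriveM (is_derive_weight t1) (is_derive_poly q t).
apply: is_derive_eq h _.
by rewrite /sl_op !hornerE /GRing.scale /=; ring.
Qed.

Lemma flux_continuous q (a b : R) : -1 <= a -> b <= 1 ->
  {within `[a, b], continuous (fun x => (1 - x ^+ 2) * weight n x * q.[x])}.
Proof.
move=> a1 b1.
have -> : (fun x => (1 - x ^+ 2) * weight n x * q.[x]) =
          (fun x => ((1 - 'X ^+ 2) * q).[x] * weight n x).
  by apply/funext => x; rewrite !hornerE mulrAC.
exact: poly_weight_continuous.
Qed.

Definition wint q (a b : R) := itv_int (fun t => q.[t] * weight n t) a b.

Lemma wint_ftc q (a b : R) : -1 <= a -> a < b -> b <= 1 ->
  wint (sl_op q) a b = (1 - b ^+ 2) * weight n b * q.[b]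
                     - (1 - a ^+ 2) * weight n a * q.[a].
Proof.
move=> a1 ab b1; rewrite /wint.
apply: (@itv_int_ftc _ (fun x => (1 - x ^+ 2) * weight n x * q.[x])) => //.
- exact: flux_continuous.
- exact: poly_weight_continuous.
- move=> x /andP[ax xb]; apply: is_derive_flux.
  by rewrite (le_lt_trans a1) //= (lt_le_trans xb).
Qed.

Lemma wintD p q (a b : R) : -1 <= a -> b <= 1 ->
  wint (p + q) a b = wint p a b + wint q a b.
Proof.
move=> a1 b1; rewrite -itv_intD; try exact: poly_weight_continuous.
by apply: eq_itv_int => x _; rewrite hornerD mulrDl.
Qed.

Lemma wintZ (k : R) p (a b : R) : -1 <= a -> b <= 1 ->
  wint (k *: p) a b = k * wint p a b.
Proof.
move=> a1 b1; rewrite -itv_intZ; try exact: poly_weight_continuous.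
by apply: eq_itv_int => x _; rewrite hornerZ mulrA.
Qed.

Lemma wint_split p (a b c : R) : -1 <= a -> a <= b -> b <= c -> c <= 1 ->
  wint p a c = wint p a b + wint p b c.
Proof.
by move=> a1 ab bc c1; apply: itv_int_split => //; apply: poly_weight_continuous.
Qed.

Lemma wdotE p q : wdot n p q = wint (p * q) (-1) 1.
Proof.
have ci : {within `[-1, 1], continuous (fun t : R => (p * q).[t] * weight n t)}.
  exact: poly_weight_continuous.
rewrite /wdot /wint /itv_int.
have -> : (fun t => p.[t] * q.[t] * weight n t) =
          (fun t => (p * q).[t] * weight n t).
  by apply/funext => t; rewrite hornerM.
have ici := itv_integrable ci.
rewrite Rintegral_itv_obnd_cbnd ?Rintegral_itv_bndo_bndc //;
  apply: integrableS ici => //.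
- by apply: subset_itvl; rewrite bnd_simp.
- by apply: subset_itv; rewrite bnd_simp.
Qed.

Lemma wdotC p q : wdot n p q = wdot n q p.
Proof. by rewrite !wdotE mulrC. Qed.

Lemma wdotD p q1 q2 : wdot n p (q1 + q2) = wdot n p q1 + wdot n p q2.
Proof. by rewrite !wdotE mulrDr wintD. Qed.

Lemma wdotZ p (k : R) q : wdot n p (k *: q) = k * wdot n p q.
Proof. by rewrite !wdotE -scalerAr wintZ. Qed.

Lemma wdotDl p q1 q2 : wdot n (q1 + q2) p = wdot n q1 p + wdot n q2 p.
Proof. by rewrite ![wdot n _ p]wdotC wdotD. Qed.

Lemma wdotZl p (k : R) q : wdot n (k *: q) p = k * wdot n q p.
Proof. by rewrite ![wdot n _ p]wdotC wdotZ. Qed.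

Lemma wdot_sum p (I : Type) (r : seq I) (A : pred I) (f : I -> {poly R}) :
  wdot n p (\sum_(i <- r | A i) f i) = \sum_(i <- r | A i) wdot n p (f i).
Proof.
apply: (big_morph (wdot n p)); first exact: wdotD.
by rewrite -(scale0r (0 : {poly R})) wdotZ mul0r.
Qed.

Lemma wdotMl p q r : wdot n (p * q) r = wdot n p (q * r).
Proof. by rewrite !wdotE mulrA. Qed.

(** A nonzero polynomial has too few roots to vanish throughout the open interval. At an interior
    point where q is positive, continuity gives a short interval on which the integrand exceeds half
    its value there. *)
Lemma wint_gt0 q (a b : R) : -1 <= a -> a < b -> b <= 1 -> q != 0 ->
  (forall t, a <= t <= b -> 0 <= q.[t]) -> 0 < wint q a b.
Proof.
move=> a1 ab b1 q0 qge0.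
have [x xab qx] : exists2 x, a < x < b & 0 < q.[x].
  apply: contrapT => h.
  suff /eqP : q = 0 by rewrite (negbTE q0).
  (* These are [size q] distinct interior points, one more than the degree allows for roots. *)
  pose s := [seq a + (b - a) / (i.+2)%:R | i <- iota 0 (size q)].
  apply: (@roots_geq_poly_eq0 _ _ s); last by rewrite size_map size_iota.
    apply/allP => _ /mapP[i _ ->].
    set y := a + _.
    have yab : a < y < b.
      have i1 : 1 < i.+2%:R :> R by rewrite ltr1n.
      rewrite /y ltrDl divr_gt0 ?subr_gt0 ?ltr0n //=.
      rewrite -ltrBDl ltr_pdivrMr ?ltr0n // ltr_pMr // subr_gt0 //.
    rewrite /root eq_le qge0; last by case/andP: yab => /ltW -> /ltW ->.
    rewrite andbT leNgt; apply/negP => qy.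
    by apply: h; exists y.
  rewrite map_inj_uniq ?iota_uniq // => i j /addrI /mulfI.
  move=> /(_ (lt0r_neq0 _)); rewrite subr_gt0 => /(_ ab) /invr_inj /eqP.
  by rewrite eqr_nat => /eqP [].
have /andP[ax xb] := xab.
have x1 : -1 < x < 1 by rewrite (le_lt_trans a1) //= (lt_le_trans xb).
pose f t := q.[t] * weight n t.
have cf : {within `[a, b], continuous f} by exact: poly_weight_continuous.
have fx : 0 < f x by rewrite mulr_gt0 // weight_gt0.
have f0 t : a <= t <= b -> 0 <= f t.
  by move=> tab; rewrite mulr_ge0 ?qge0 ?weight_ge0.
have cx : {for x, continuous f}.
  by apply: (within_continuous_continuous ab cf); rewrite in_itv /= ax.
(* The condition [y < b] is carried along so that the interval chosen to the right of x stays inside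
   [a, b]. *)
have : \forall y \near x, f x / 2 < f y /\ y < b.
  near=> y; split; near: y; last exact: (cvgr_lt x).
  apply: (cvgr_gt (f x)) => //; lra.
move=> /nbhs_ballP [e /= e0 he].
have [d [d0 de]] : exists d : R, 0 < d /\ d < e by exists (e / 2); lra.
have xd y : x <= y <= x + d -> f x / 2 < f y /\ y < b.
  move=> /andP[xy yd]; apply: he; rewrite /ball /= ltr_norml; lra.
have [_ xdb] : f x / 2 < f (x + d) /\ x + d < b by apply: xd; lra.
apply: (@lt_le_trans _ _ (itv_int f x (x + d))); last first.
  by apply: itv_int_ge_sub => //; lra.
apply: (@lt_le_trans _ _ (f x / 2 * (x + d - x))).
  by rewrite mulr_gt0 ?divr_gt0 //; lra.
rewrite -itv_int_cst ?lerDl ?(ltW d0) //.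
apply: itv_int_le => //.
- by apply: continuous_subspaceT => ?; exact: cst_continuous.
- apply: continuous_subspaceW cf.
  by apply: subset_itv; rewrite bnd_simp ltW.
- by move=> y /xd [/ltW].
Unshelve. all: by end_near.
Qed.

Lemma wdot_gt0 p : p != 0 -> 0 < wdot n p p.
Proof.
move=> p0; rewrite wdotE; apply: wint_gt0; rewrite ?mulf_neq0 ?gtrN //.
by move=> t _; rewrite hornerM -expr2 sqr_ge0.
Qed.

Lemma sl_opM p q : sl_op (p * q) = sl_op p * q + (1 - 'X ^+ 2) * (p * q^`()).
Proof. by rewrite /sl_op derivM -!mul_polyC; ring. Qed.

(** Integration by parts: the flux vanishes at -1 and 1 because 1 - t^2 does, so both sides equal
    minus the integral of (1 - t^2) p' q' against the weight, which is symmetric in p and q. *)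
Lemma wdot_sl_opC p q :
  wdot n (sl_op p^`()) q = wdot n p (sl_op q^`()).
Proof.
have bnd f : wint (sl_op f) (-1) 1 = 0.
  by rewrite wint_ftc //; [ring|lra..].
have E f g : wdot n (sl_op f^`()) g =
    - wint ((1 - 'X ^+ 2) * (f^`() * g^`())) (-1) 1.
  apply/eqP; rewrite -addr_eq0 wdotE -wintD // -sl_opM bnd //.
by rewrite E [RHS]wdotC E [in RHS](mulrC q^`()).
Qed.

End Weight.

(** * Products of linear factors to the right of their roots, and signs between roots *)

Section RootProducts.
Context {R : realType}.
Implicit Types (l : seq R) (x d t : R).

Lemma prod_XsubC_nneg_mono l x t d :
  (forall a, a \in l -> a <= x) -> x <= t -> t <= d ->
  let g := \prod_(a <- l) ('X - a%:P) in 0 <= g.[t] /\ g.[t] <= g.[d].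
Proof.
move=> lx xt td /=; elim: l lx => [|a l IH] lx.
  by rewrite big_nil !hornerE.
have [g0 gm] : _ /\ _ := IH (fun b bl => lx b (mem_behead (s := a :: l) bl)).
have ax : a <= x by apply: lx; rewrite mem_head.
rewrite !big_cons !hornerM !hornerXsubC; split.
  by rewrite mulr_ge0 // subr_ge0 (le_trans ax).
by rewrite ler_pM // ?lerB // subr_ge0 (le_trans ax).
Qed.

(** Each factor satisfies (t - a) / (d - a) >= 1 - (d - t) / (d - x), and a product of k such
    factors loses at most k times that amount, as in Bernoulli's inequality. Cleared of
    denominators, this also covers d = x. *)
Lemma prod_XsubC_lower l x t d :
  (forall a, a \in l -> a <= x) -> x <= t -> t <= d ->
  let g := \prod_(a <- l) ('X - a%:P) in
  g.[d] * ((d - x) - (size l)%:R * (d - t)) <= g.[t] * (d - x).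
Proof.
move=> lx xt td /=; elim: l lx => [|a l IH] lx.
  by rewrite big_nil !hornerE /=; lra.
have lx' b : b \in l -> b <= x by move=> bl; apply: lx; rewrite inE bl orbT.
have := IH lx'; have [] := prod_XsubC_nneg_mono lx' xt td.
have ax : a <= x by apply: lx; rewrite mem_head.
rewrite !big_cons !hornerM !hornerXsubC /= -natr1.
set gd := _.[d]; set gt := _.[t]; set k := _%:R => g0 gm H.
have h1 : (d - a) * (gd * (d - x - k * (d - t))) <= (d - a) * (gt * (d - x)).
  by rewrite ler_wpM2l //; lra.
have h2 : (d - t) * (gt * (d - x)) <= (d - t) * (gd * (d - a)).
  rewrite ler_wpM2l ?subr_ge0 // ler_pM //; lra.
lra.
Qed.

(** The logarithmic derivative at d is the sum of the 1 / (d - a), each at most 1 / (d - x). *)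
Lemma prod_XsubC_deriv l x d :
  (forall a, a \in l -> a <= x) -> x <= d ->
  let g := \prod_(a <- l) ('X - a%:P) in
  0 <= g^`().[d] /\ g^`().[d] * (d - x) <= (size l)%:R * g.[d].
Proof.
move=> lx xd /=; elim: l lx => [|a l IH] lx.
  by rewrite big_nil -polyC1 derivC !hornerE /=; lra.
have lx' b : b \in l -> b <= x by move=> bl; apply: lx; rewrite inE bl orbT.
have := IH lx'; have [] := prod_XsubC_nneg_mono lx' xd (lexx d).
have ax : a <= x by apply: lx; rewrite mem_head.
rewrite !big_cons derivM derivXsubC mul1r hornerD !hornerM !hornerXsubC /=.
rewrite -natr1.
set g := _.[d]; set g' := _.[d]; set k := _%:R => g0 _ [g'0 H].
have h : (d - a) * (g' * (d - x)) <= (d - a) * (k * g) by rewrite ler_wpM2l //; lra.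
have h2 : g * (d - x) <= g * (d - a) by rewrite ler_wpM2l //; lra.
split; last lra.
by rewrite addr_ge0 // mulr_ge0 //; lra.
Qed.

(** Inner roots are divided out one at a time, by induction on the size, so [l] lists them with
    multiplicity. *)
Lemma split_inner_roots (p : {poly R}) : p != 0 ->
  exists l (q : {poly R}), [/\ p = q * \prod_(a <- l) ('X - a%:P),
    forall a, a \in l -> -1 < a < 1 & forall t, -1 < t < 1 -> ~~ root q t].
Proof.
have [m] := ubnP (size p); elim: m p => // m IH p; rewrite ltnS => pm p0.
have [[t t1 rt]|noroot] := pselect (exists2 t, -1 < t < 1 & root p t); last first.
  exists [::], p; split => //; first by rewrite big_nil mulr1.
  by move=> t t1; apply/negP => rt; apply: noroot; exists t.
have [p1 pE] := factor_theorem _ _ rt.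
have p10 : p1 != 0 by apply: contraNneq p0 => z; rewrite pE z mul0r.
have [|l [q [qE lP qP]]] := IH p1 _ p10.
  by rewrite (leq_trans _ pm) // pE size_Mmonic ?monicXsubC // size_XsubC addn2.
exists (t :: l), q; split => //.
  by rewrite big_cons pE qE mulrAC mulrA.
by move=> a; rewrite inE => /orP[/eqP->//|]; apply: lP.
Qed.

(** Two values of strictly opposite sign would force a root strictly between them. Zeros at the
    endpoints remain possible, hence the weak inequalities. *)
Lemma no_inner_root_sign (q : {poly R}) :
  (forall t, -1 < t < 1 -> ~~ root q t) ->
  (forall t, -1 <= t <= 1 -> 0 <= q.[t]) \/
  (forall t, -1 <= t <= 1 -> q.[t] <= 0).
Proof.
move=> qP.
have key s t (p : {poly R}) : -1 <= s -> t <= 1 -> s <= t ->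
    (forall t, -1 < t < 1 -> ~~ root p t) -> p.[s] < 0 -> 0 < p.[t] -> False.
  move=> s1 t1 st pP ps pt.
  have [|x /andP[sx xt] rx] := @poly_ivt _ p s t st; first by rewrite !ltW.
  have xs : x != s by apply: contraTneq rx => ->; rewrite /root lt_eqF.
  have xt' : x != t by apply: contraTneq rx => ->; rewrite /root gt_eqF.
  move: (pP x); rewrite rx => /(_ _)/negP; apply => //.
  have sx' : s < x by rewrite lt_neqAle eq_sym xs.
  have xt'' : x < t by rewrite lt_neqAle xt'.
  by rewrite (le_lt_trans s1) // (lt_le_trans xt'').
have [[s s1 qs]|h] := pselect (exists2 s, -1 <= s <= 1 & q.[s] < 0); last first.
  left=> t t1; rewrite leNgt; apply/negP => qt; apply: h; exists t => //.
right=> t t1; rewrite leNgt; apply/negP => qt.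
have /andP[s1l s1r] := s1; have /andP[t1l t1r] := t1.
case: (leP s t) => st; first exact: (key s t q).
apply: (key t s (- q)) => //; rewrite ?ltW // ?hornerN ?oppr_lt0 ?oppr_gt0 //.
by move=> y y1; rewrite rootN qP.
Qed.

End RootProducts.

(** * The orthogonal family: expansions and location of the roots *)

Section Gegenbauer.
Context {R : realType}.
Variables (n : nat) (P : nat -> {poly R}).
Hypotheses (n_gt3 : (3 < n)%N) (famP : jacobi_family n P).
Implicit Types (p q : {poly R}) (s : nat).

Lemma size_fam s : size (P s) = s.+1. Proof. by case: famP. Qed.

Lemma fam_neq0 s : P s != 0. Proof. by rewrite -size_poly_eq0 size_fam. Qed.

Lemma fam_norm_gt0 s : 0 < wdot n (P s) (P s).
Proof. by rewrite wdot_gt0 // fam_neq0. Qed.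

Lemma fam1_gt0 s : 0 < (P s).[1].
Proof.
case: famP => _ _ ->; rewrite /gbinom divr_gt0 ?ltr0n ?fact_gt0 //.
apply: prodr_gt0 => i _.
have h : i%:R <= s%:R :> R by rewrite ler_nat ltnW.
by have := @alpha_gt0 R n n_gt3; lra.
Qed.

Lemma fam_span q m : (size q <= m)%N -> exists c : nat -> R,
  q = \sum_(k < m) c k *: P k.
Proof.
elim: m q => [|m IH] q sq.
  exists (fun=> 0); rewrite big_ord0; apply/eqP.
  by rewrite -size_poly_eq0 -leqn0.
have lc : (P m)`_m != 0.
  by have := fam_neq0 m; rewrite -lead_coef_eq0 lead_coefE size_fam.
pose k := q`_m / (P m)`_m.
have [|c qE] := IH (q - k *: P m).
  apply/leq_sizeP => j; rewrite leq_eqVlt => /orP[/eqP<-|mj].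
    by rewrite coefB coefZ /k divfK // subrr.
  rewrite coefB coefZ [q`_j]nth_default ?(leq_trans sq) //.
  by rewrite [(P m)`_j]nth_default ?size_fam // mulr0 subrr.
exists (fun j => if j == m then k else c j).
rewrite big_ord_recr /= eqxx -[LHS](subrK (k *: P m)) qE; congr (_ + _).
by apply: eq_bigr => i _; rewrite ltn_eqF.
Qed.

Lemma fam_orth s k : s <> k -> wdot n (P s) (P k) = 0.
Proof. by case: famP => _ + _; apply. Qed.

Lemma fam_orth_low s q : (size q <= s)%N -> wdot n (P s) q = 0.
Proof.
move=> /fam_span[c ->]; rewrite wdot_sum // big1 // => k _.
rewrite wdotZ // fam_orth ?mulr0 // => sk.
by have := ltn_ord k; rewrite -sk ltnn.
Qed.

Lemma fam_expand q m : (size q <= m)%N ->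
  q = \sum_(k < m) (wdot n q (P k) / wdot n (P k) (P k)) *: P k.
Proof.
move=> /fam_span[c qE]; rewrite {1}qE; apply: eq_bigr => k _; congr (_ *: _).
apply: (canRL (mulfK _)); first by rewrite gt_eqF // fam_norm_gt0.
rewrite wdotC // qE wdot_sum // (bigD1 k) //= big1 ?addr0 ?wdotZ // => j jk.
rewrite wdotZ // fam_orth ?mulr0 // => /ord_inj kj.
by rewrite kj eqxx in jk.
Qed.

(** Let g collect the inner roots, so that [P s] is q g with q of constant sign on [-1, 1]. If g had
    degree below s, orthogonality would make the integral of q g^2 against the weight zero, which
    positivity forbids. Hence q is constant. *)
Lemma fam_inner_roots s : exists l (c : R),
  [/\ P s = c *: \prod_(a <- l) ('X - a%:P), 0 < c, size l = s
    & forall a, a \in l -> -1 < a < 1].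
Proof.
have [l [q [PE lP qP]]] := split_inner_roots (fam_neq0 s).
set g := \prod_(a <- l) _ in PE.
have gm : g \is monic by exact: monic_prod_XsubC.
have q0 : q != 0 by apply: contraTneq (fam_neq0 s) => z; rewrite PE z mul0r eqxx.
have g0 : g != 0 by exact: monic_neq0.
have sg : size g = (size l).+1 by rewrite size_prod_XsubC.
have sE : (s.+1 = size q + size l)%N.
  by rewrite -(size_fam s) PE size_Mmonic // sg addnS.
have sl : (s <= size l)%N.
  rewrite leqNgt; apply/negP => ls.
  have z : wdot n (P s) g = 0 by rewrite fam_orth_low // sg.
  have h f : f != 0 -> (forall t, -1 <= t <= 1 -> 0 <= f.[t]) ->
      wint n (f * (g * g)) (-1) 1 != 0.
    move=> f0 fge; rewrite gt_eqF //; apply: wint_gt0; rewrite ?gtrN ?mulf_neq0 //.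
    by move=> t t1; rewrite !hornerM mulr_ge0 ?fge // -expr2 sqr_ge0.
  have [qge|qle] := no_inner_root_sign qP.
    by have /eqP := h q q0 qge; apply; rewrite -z wdotE // PE mulrA.
  have q0' : - q != 0 by rewrite oppr_eq0.
  have q1 t : -1 <= t <= 1 -> 0 <= (- q).[t].
    by move=> t1; rewrite hornerN oppr_ge0 qle.
  have /eqP := h (- q) q0' q1; apply.
  by rewrite mulNr -scaleN1r wintZ ?gtrN // mulrA -PE -wdotE // z mulr0.
have [sq1 sls] : size q = 1%N /\ size l = s.
  have := q0; rewrite -size_poly_gt0; move: sE sl.
  by move: (size q) (size l) => x y; lia.
have /size_poly1P[c c0 qE] : size q == 1%N by rewrite sq1.
exists l, c; split=> //; first by rewrite PE qE mul_polyC.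
(* The sign of the leading coefficient is read off at 1, where every linear factor is positive. *)
have := fam1_gt0 s; rewrite PE qE mul_polyC hornerZ.
rewrite pmulr_lgt0 //.
rewrite /g horner_prod big_seq; apply: prodr_gt0 => a al.
by have /andP[_ a1] := lP a al; rewrite hornerXsubC subr_gt0.
Qed.

(** * The Gegenbauer differential equation *)

Definition sl_eigen s : R := s%:R * (s%:R + n%:R - 2).

(** On monomials the operator is triangular with diagonal [- sl_eigen i]: it does not raise degrees,
    and its effect on the leading coefficient identifies the eigenvalue. *)
Lemma coef_sl_op_deriv p i : (sl_op n p^`())`_i =
  (i.+1 * i.+2)%:R * p`_i.+2 - sl_eigen i * p`_i.
Proof.
rewrite /sl_op /sl_eigen mulrBl mul1r coefB coefZ coefXM coefB coefXnM.
case: i => [|[|i]] /=; rewrite !coef_deriv -?mulrnA -!(mulr_natl p`__) ?natrM.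
- by rewrite subr0; ring.
- by rewrite subr0; ring.
rewrite subn2 /= -!natr1; move: (i%:R : R) => x; ring.
Qed.

Lemma size_sl_op_deriv p : (size (sl_op n p^`()) <= size p)%N.
Proof.
apply/leq_sizeP => j pj.
by rewrite coef_sl_op_deriv !nth_default ?mulr0 ?subr0 // ltnW // ltnW.
Qed.

(** The defect E has degree below s because the leading terms cancel. It is orthogonal to itself:
    [P s] is orthogonal to E, and by self-adjointness the operator term pairs with E as [P s] pairs
    with a polynomial of degree below s. Hence E = 0. *)
Lemma fam_ode s : sl_op n (P s)^`() = - sl_eigen s *: P s.
Proof.
apply/eqP; rewrite scaleNr -addr_eq0; set E := _ + _.
have sE : (size E <= s)%N.
  apply/leq_sizeP => j sj; rewrite coefD coefZ coef_sl_op_deriv.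
  rewrite [(P s)`_j.+2]nth_default ?size_fam ?ltnS ?(leqW sj) //.
  rewrite mulr0 sub0r; move: sj; rewrite leq_eqVlt.
  move=> /orP[/eqP<-|sj]; first by rewrite addNr.
  by rewrite nth_default ?size_fam // !mulr0 oppr0 addr0.
apply: contraT => E0; have := wdot_gt0 n_gt3 E0.
rewrite {1}/E wdotDl // wdotZl // (fam_orth_low sE) mulr0 addr0.
rewrite wdot_sl_opC // fam_orth_low ?ltxx //.
exact: leq_trans (size_sl_op_deriv E) sE.
Qed.

(** * Derivatives at 1, the three-term recurrence and the growth of P_s(1) / ||P_s|| *)

Lemma fam_deriv1 s :
  (n%:R - 1) * (P s)^`().[1] = sl_eigen s * (P s).[1].
Proof.
have /(congr1 (fun p => p.[1])) := fam_ode s.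
by rewrite /sl_op !hornerE /= => h; lra.
Qed.

(** The differential equation is differentiated once before setting t = 1, where the term of highest
    order drops out; the added 2 comes from the derivative of 1 - t^2. *)
Lemma fam_deriv2 s : (n%:R - 1 + 2) * (P s)^`()^`().[1] =
  (sl_eigen s - (n%:R - 1)) * (P s)^`().[1].
Proof.
have /(congr1 (fun p => p^`().[1])) := fam_ode s.
rewrite /sl_op derivB !derivZ !derivM derivB derivXn -polyC1 derivC derivX.
rewrite !hornerE /= => h; lra.
Qed.

(** Here S stands for n - 1; v and u are values and first derivatives at 1 of three consecutive
    members, and l their eigenvalues. The derivatives are eliminated, leaving a relation between
    values. The next lemma does the same with second derivatives w. *)
Lemma recurrence_at1_deriv1 (S a b c v0 v1 v2 u0 u1 u2 l0 l1 l2 : R) :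
  S * u0 = l0 * v0 -> S * u1 = l1 * v1 -> S * u2 = l2 * v2 ->
  v1 + u1 = b * u0 + c * u1 + a * u2 ->
  a * v2 * l2 + c * v1 * l1 + b * v0 * l0 = v1 * (l1 + S).
Proof.
move=> e0 e1 e2 h.
transitivity (a * (l2 * v2) + c * (l1 * v1) + b * (l0 * v0)); first by ring.
rewrite -e0 -e1 -e2; transitivity (S * (b * u0 + c * u1 + a * u2)); first by ring.
by rewrite -h mulrDr e1; ring.
Qed.

Lemma recurrence_at1_deriv2
    (S a b c v0 v1 v2 u0 u1 u2 w0 w1 w2 l0 l1 l2 : R) :
  S * u0 = l0 * v0 -> S * u1 = l1 * v1 -> S * u2 = l2 * v2 ->
  (S + 2) * w0 = (l0 - S) * u0 -> (S + 2) * w1 = (l1 - S) * u1 ->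
  (S + 2) * w2 = (l2 - S) * u2 ->
  2 * u1 + w1 = b * w0 + c * w1 + a * w2 ->
  a * v2 * (l2 * (l2 - S)) + c * v1 * (l1 * (l1 - S)) + b * v0 * (l0 * (l0 - S))
  = v1 * (l1 * (l1 - S) + 2 * (S + 2) * l1).
Proof.
move=> e0 e1 e2 f0 f1 f2 h.
have k (v u w l : R) : S * u = l * v -> (S + 2) * w = (l - S) * u ->
    S * ((S + 2) * w) = v * (l * (l - S)).
  by move=> e f; rewrite f mulrCA e; ring.
transitivity (a * (v2 * (l2 * (l2 - S))) + c * (v1 * (l1 * (l1 - S)))
              + b * (v0 * (l0 * (l0 - S)))); first by ring.
rewrite -(k _ _ _ _ e0 f0) -(k _ _ _ _ e1 f1) -(k _ _ _ _ e2 f2).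
transitivity (S * ((S + 2) * (b * w0 + c * w1 + a * w2))); first by ring.
rewrite -h; transitivity (2 * (S + 2) * (S * u1) + S * ((S + 2) * w1)).
  by ring.
by rewrite (k _ _ _ _ e1 f1) e1; ring.
Qed.

(* The three equations are X P_s = a' P_{s+1} + c' P_s + b' P_{s-1}, its first and
   its second derivative at 1, with a = a' P_{s+1}(1) and so on; they determine
   a' and b' without using the parity of P_s. *)
Lemma recurrence_solve (S x v a b c : R) : 0 < S -> 1 <= x ->
  let lam y := y * (y + S - 1) in
  a + c + b = v ->
  a * lam (x + 1) + c * lam x + b * lam (x - 1) = v * (lam x + S) ->
  a * (lam (x + 1) * (lam (x + 1) - S)) + c * (lam x * (lam x - S))
    + b * (lam (x - 1) * (lam (x - 1) - S))
    = v * (lam x * (lam x - S) + 2 * (S + 2) * lam x) ->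
  a * (2 * x + S - 1) = v * (x + S - 1) /\ b * (2 * x + S - 1) = v * x.
Proof.
move=> S0 x1 lam e1 e2 e3.
have ha : a * (2 * x + S - 1) = v * (x + S - 1).
  have nz : 2 * (2 * x + S) != 0 by rewrite gt_eqF //; lra.
  apply: (mulfI nz); apply/eqP; rewrite -subr_eq0; apply/eqP.
  set f1 := a + c + b - v.
  set f2 := a * lam (x + 1) + c * lam x + b * lam (x - 1) - v * (lam x + S).
  set f3 := a * (lam (x + 1) * (lam (x + 1) - S)) + c * (lam x * (lam x - S))
    + b * (lam (x - 1) * (lam (x - 1) - S))
    - v * (lam x * (lam x - S) + 2 * (S + 2) * lam x).
  (* The equations are combined into the quadratic (l - lam x) (l - lam (x - 1)) in the eigenvalue
     l, which vanishes at the nodes carrying c and b and so isolates a. *)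
  have -> : 2 * (2 * x + S) * (a * (2 * x + S - 1)) -
            2 * (2 * x + S) * (v * (x + S - 1)) =
     f3 - (lam x + lam (x - 1) - S) * f2 + lam x * lam (x - 1) * f1.
    by rewrite /f1 /f2 /f3 /lam; ring.
  by rewrite /f1 /f2 /f3 e1 e2 e3 !subrr !mulr0 subr0 addr0.
split => //.
have nz : 2 * x + S - 2 != 0 by rewrite gt_eqF //; lra.
apply: (mulfI nz).
(* Subtracting [lam x] times the first equation from the second eliminates c. *)
have f : a * (2 * x + S) - b * (2 * x + S - 2) = v * S.
  have : (a * lam (x + 1) + c * lam x + b * lam (x - 1)) - lam x * (a + c + b) =
          v * (lam x + S) - lam x * v by rewrite e1 e2.
  by rewrite /lam => h; lra.
have -> : (2 * x + S - 2) * (b * (2 * x + S - 1)) =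
   (a * (2 * x + S) - v * S) * (2 * x + S - 1) by rewrite -f; ring.
rewrite mulrBl mulrAC ha; ring.
Qed.

Lemma fam_recurrence s : (0 < s)%N ->
  let D : R := 2 * s%:R + n%:R - 2 in
  wdot n ('X * P s) (P s.+1) / wdot n (P s.+1) (P s.+1) * (P s.+1).[1] * D
    = (P s).[1] * (s%:R + n%:R - 2) /\
  wdot n ('X * P s) (P s.-1) / wdot n (P s.-1) (P s.-1) * (P s.-1).[1] * D
    = (P s).[1] * s%:R.
Proof.
case: s => // s _ D /=.
set a := _ / _; set b := _ / wdot n (P s) (P s).
have : (size ('X * P s.+1)%R <= s.+3)%N.
  by rewrite mulrC size_mulX ?fam_neq0 // size_fam.
move=> /fam_expand; rewrite !big_ord_recr /= big1 ?add0r; last first.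
  (* Moving X to the other factor gives X P_k, whose degree is still too low to pair with
     [P s.+1]. *)
  move=> k _; rewrite ['X * _]mulrC wdotMl // fam_orth_low ?mul0r ?scale0r //.
  by rewrite mulrC size_mulX ?fam_neq0 // size_fam !ltnS ltn_ord.
rewrite -/a -/b; set c := _ / wdot n (P s.+1) (P s.+1) => e.
have S0 : 0 < n%:R - 1 :> R by rewrite subr_gt0 ltr1n; lia.
have x1 : 1 <= s.+1%:R :> R by rewrite ler1n.
have := @recurrence_solve (n%:R - 1) s.+1%:R (P s.+1).[1]
  (a * (P s.+2).[1]) (b * (P s).[1]) (c * (P s.+1).[1]) S0 x1.
have lamE k : k%:R * (k%:R + (n%:R - 1) - 1) = sl_eigen k.
  by rewrite /sl_eigen; ring.
have -> : s.+1%:R + 1 = s.+2%:R :> R by rewrite natr1.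
have -> : s.+1%:R - 1 = s%:R :> R by rewrite -natr1 addrK.
rewrite /= !lamE.
move=> /(_ _ _ _)[].
- have /(congr1 (fun p => p.[1])) := e.
  by rewrite !hornerE /= => h; lra.
- apply: recurrence_at1_deriv1 (fam_deriv1 _) (fam_deriv1 _) (fam_deriv1 _) _.
  have /(congr1 (fun p => p^`().[1])) := e.
  by rewrite !(derivD, derivZ, derivM, derivX) !hornerE /= => h; lra.
- apply: recurrence_at1_deriv2 (fam_deriv1 _) (fam_deriv1 _) (fam_deriv1 _)
    (fam_deriv2 _) (fam_deriv2 _) (fam_deriv2 _) _.
  have /(congr1 (fun p => p^`()^`().[1])) := e.
  by rewrite !(derivD, derivZ, derivM, derivX, mul1r) !hornerE /= => h; lra.
rewrite /D => ha hb; split; lra.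
Qed.

(** The upward coefficient at s and the downward one at s + 1 contain the same integral M of x P_s
    P_{s+1} against the weight. Eliminating M expresses the quotient of the two sides by explicit
    factors, which are compared in [K]. *)
Lemma fam_ratio_step s : (0 < s)%N ->
  (P s).[1] ^+ 2 * wdot n (P s.+1) (P s.+1) <=
  (P s.+1).[1] ^+ 2 * wdot n (P s) (P s).
Proof.
move=> s0.
have [ha _] := fam_recurrence s0.
have [_ hb] := @fam_recurrence s.+1 isT.
move: ha hb => /=.
have -> : wdot n ('X * P s.+1) (P s) = wdot n ('X * P s) (P s.+1).
  by rewrite !wdotE // mulrAC.
set M := wdot n ('X * P s) _; set N1 := wdot n (P s.+1) _; set N0 := wdot n (P s) _.
have N10 : 0 < N1 := fam_norm_gt0 s.+1.
have N00 : 0 < N0 := fam_norm_gt0 s.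
have v0 := fam1_gt0 s; have v1 := fam1_gt0 s.+1.
set v := (P s).[1] in v0 *; set w := (P s.+1).[1] in v1 *.
have x1 : 1 <= s%:R :> R by rewrite ler1n.
have n4 : 4 <= n%:R :> R by rewrite (ler_nat _ 4).
rewrite -[s.+1%:R]natr1; set x := s%:R in x1 *; set m := n%:R in n4 *.
set D0 := 2 * x + m - 2; set D1 := 2 * (x + 1) + m - 2 => ha hb.
have D00 : 0 < D0 by rewrite /D0; lra.
have D10 : 0 < D1 by rewrite /D1; lra.
have MA : M * w * D0 = v * (x + m - 2) * N1.
  by rewrite -ha; field; rewrite gt_eqF.
have MB : M * v * D1 = w * (x + 1) * N0.
  by rewrite -hb; field; rewrite gt_eqF.
have E : v ^+ 2 * N1 * ((x + m - 2) * D1) = w ^+ 2 * N0 * ((x + 1) * D0).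
  transitivity (v * D1 * (v * (x + m - 2) * N1)); first by ring.
  rewrite -MA; transitivity (w * D0 * (M * v * D1)); first by ring.
  by rewrite MB; ring.
have K : (x + 1) * D0 <= (x + m - 2) * D1 by rewrite /D0 /D1; nra.
have K0 : 0 < (x + m - 2) * D1 by rewrite mulr_gt0 //; lra.
rewrite -(ler_pM2r K0) E ler_wpM2l // mulr_ge0 ?sqr_ge0 //.
exact: ltW.
Qed.

Lemma fam_ratio_le s t : (0 < s)%N -> (s <= t)%N ->
  (P s).[1] / wnorm n (P s) <= (P t).[1] / wnorm n (P t).
Proof.
move=> s0; elim: t => [|t IH]; first by rewrite leqn0 => /eqP ->.
rewrite leq_eqVlt => /orP[/eqP->//|]; rewrite ltnS => st.
apply: le_trans (IH st) _.
have N10 := fam_norm_gt0 t.+1; have N00 := fam_norm_gt0 t.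
have v0 := fam1_gt0 t; have v1 := fam1_gt0 t.+1.
rewrite ler_pdivrMr ?sqrtr_gt0 // mulrAC ler_pdivlMr ?sqrtr_gt0 //.
rewrite -ler_sqr ?nnegrE ?mulr_ge0 ?sqrtr_ge0 ?(ltW v0) ?(ltW v1) // !exprMn.
rewrite !sqr_sqrtr ?(ltW N10) ?(ltW N00) //.
exact: fam_ratio_step (leq_trans s0 st).
Qed.

End Gegenbauer.

(** * The largest root: monotonicity in the degree, tail integrals and existence of r *)

Section TopRoot.
Context {R : realType}.
Variables (n : nat) (P : nat -> {poly R}).
Hypotheses (n_gt3 : (3 < n)%N) (famP : jacobi_family n P).
Implicit Types (p q : {poly R}) (s r : nat) (x y t d : R).

Lemma fam_top_root s : (0 < s)%N ->
  exists2 x, is_max [set t | root (P s) t] x & -1 < x < 1.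
Proof.
move=> s0; have [l [c [PE c0 sl lP]]] := fam_inner_roots n_gt3 famP s.
have rE t : root (P s) t = (t \in l).
  by rewrite PE rootZ ?gt_eqF // root_prod_XsubC.
have [x xl xmax] : exists2 x, x \in l & forall a, a \in l -> a <= x.
  have : l != [::] by rewrite -size_eq0 sl -lt0n.
  elim: (l) => // a l' IH _; have [->|l0] := eqVneq l' [::].
    by exists a; rewrite ?mem_head // => b; rewrite inE => /eqP ->.
  have [x xl xm] := IH l0.
  exists (Num.max a x).
    by rewrite inE maxEle; case: ifP => _; rewrite ?xl ?eqxx ?orbT.
  by move=> b; rewrite inE le_max => /orP[/eqP->|/xm ->]; rewrite ?lexx ?orbT.
exists x; last exact: lP.
by split=> /= [|t /=]; rewrite rE //; apply: xmax.
Qed.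

Lemma fam_right_of_top_root s x t d :
  is_max [set t | root (P s) t] x -> x <= t -> t <= d ->
  [/\ 0 <= (P s).[t], (P s).[t] <= (P s).[d]
    & (P s).[d] * ((d - x) - s%:R * (d - t)) <= (P s).[t] * (d - x)].
Proof.
move=> [/= rx ubx] xt td.
have [l [c [PE c0 sl lP]]] := fam_inner_roots n_gt3 famP s.
have lx a : a \in l -> a <= x.
  move=> al; apply: ubx => /=.
  by rewrite PE rootZ ?gt_eqF // root_prod_XsubC.
have [h1 h2] := prod_XsubC_nneg_mono lx xt td.
have h3 := prod_XsubC_lower lx xt td.
rewrite PE !hornerZ -!mulrA; rewrite sl in h3; split.
- by rewrite mulr_ge0 // ltW.
- by rewrite ler_pM2l.
- by rewrite ler_pM2l.
Qed.

Lemma fam_gt0_right s x d :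
  is_max [set t | root (P s) t] x -> x < d -> 0 < (P s).[d].
Proof.
move=> mx xd.
have [h _ _] := fam_right_of_top_root mx (ltW xd) (lexx d).
rewrite lt_neqAle h andbT eq_sym; apply: contraTneq xd => z.
by rewrite -leNgt; case: mx => _; apply; apply/eqP.
Qed.

Lemma fam_deriv_right s x d :
  is_max [set t | root (P s) t] x -> x <= d ->
  0 <= (P s)^`().[d] /\ (P s)^`().[d] * (d - x) <= s%:R * (P s).[d].
Proof.
move=> [/= rx ubx] xd.
have [l [c [PE c0 sl lP]]] := fam_inner_roots n_gt3 famP s.
have lx a : a \in l -> a <= x.
  move=> al; apply: ubx => /=.
  by rewrite PE rootZ ?gt_eqF // root_prod_XsubC.
have [h1 h2] := prod_XsubC_deriv lx xd.
rewrite sl in h2.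
rewrite PE derivZ !hornerZ -!mulrA; split; first by rewrite mulr_ge0 // ltW.
by rewrite [leRHS]mulrCA ler_pM2l.
Qed.

Lemma sl_eigen_lt s r : (s < r)%N -> sl_eigen n s < sl_eigen n r :> R.
Proof.
move=> sr; rewrite /sl_eigen.
have s0 : 0 <= s%:R :> R by [].
have h : s%:R < r%:R :> R by rewrite ltr_nat.
have n4 : 4 <= n%:R :> R by rewrite (ler_nat _ 4).
nra.
Qed.

(* Sturm comparison of the two Sturm-Liouville equations to the right of the
   top root of P_s. *)
Lemma top_root_mono s r x y : (s < r)%N ->
  is_max [set t | root (P s) t] y -> is_max [set t | root (P r) t] x ->
  y < 1 -> -1 < y -> y <= x.
Proof.
move=> sr my mx y1 ym1; rewrite leNgt; apply/negP => xy.
(* This is the Wronskian. Its flux (1 - t^2) w q vanishes at 1 and is nonnegative at y, yet if x < y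
   its derivative is positive on ]y, 1[; the mean value theorem gives the contradiction. *)
pose q := (P s)^`() * P r - P s * (P r)^`().
have qE : sl_op n q = (sl_eigen n r - sl_eigen n s) *: (P s * P r).
  have -> : sl_op n q = sl_op n (P s)^`() * P r - P s * sl_op n (P r)^`().
    by rewrite /q /sl_op !(derivB, derivM) -!mul_polyC; ring.
  rewrite !(fam_ode n_gt3 famP) -scalerAl -scalerAr -scalerBl; congr (_ *: _).
  by ring.
have [|c|c] := @MVT R (fun t => (1 - t ^+ 2) * weight n t * q.[t])
    (fun t => (sl_op n q).[t] * weight n t) y 1 y1.
- move=> c; rewrite in_itv /= => /andP[yc c1].
  by apply: is_derive_flux; rewrite ?(lt_trans ym1).
- by apply: flux_continuous; rewrite // ltW.
rewrite in_itv /= => /andP[yc c1].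
rewrite expr1n subrr !mul0r sub0r => h.
have ry : (P s).[y] = 0 by apply/eqP; case: my.
have [dy _] := fam_deriv_right my (lexx y).
have wy : 0 < weight n y by rewrite weight_gt0 // ym1.
have y2 : 0 < 1 - y ^+ 2 by rewrite oneB_sqr_gt0 // ym1.
have Pry := fam_gt0_right mx xy.
have : 0 <= (1 - y ^+ 2) * weight n y * q.[y].
  rewrite mulr_ge0 ?mulr_ge0 ?(ltW y2) ?(ltW wy) //.
  by rewrite /q !hornerE /= ry mul0r subr0 mulr_ge0 // ltW.
suff : 0 < (sl_op n q).[c] * weight n c * (1 - y) by rewrite -h; lra.
rewrite qE hornerZ hornerM.
have := sl_eigen_lt sr.
have := fam_gt0_right my yc; have := fam_gt0_right mx (lt_trans xy yc).
have wc : 0 < weight n c by rewrite weight_gt0 // c1 (lt_trans ym1).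
move=> h1 h2 h3.
by rewrite !mulr_gt0 // subr_gt0.
Qed.

(** At t = 0 the first-order term of the differential equation vanishes, and P_1'' = 0, so the
    eigenvalue times P_1(0) is zero. *)
Lemma root_fam1_0 : root (P 1%N) 0.
Proof.
have /(congr1 (fun p => p.[0])) := fam_ode n_gt3 famP 1.
have d2 : (P 1%N)^`()^`() = 0.
  apply/polyP => i; rewrite coef0 !coef_deriv nth_default ?mul0rn //.
  by rewrite (size_fam famP).
rewrite /sl_op d2 !hornerE /= mulr0 mul0r oppr0.
have e0 : 0 < sl_eigen n 1 :> R.
  by have := sl_eigen_lt (ltn0Sn 0); rewrite {1}/sl_eigen mul0r.
by move=> /esym/eqP; rewrite mulf_eq0 oppr_eq0 (gt_eqF e0).
Qed.

(** Top roots do not decrease with the degree, and [P 1] has the root 0. *)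
Lemma top_root_ge0 s x : (0 < s)%N -> is_max [set t | root (P s) t] x -> 0 <= x.
Proof.
move=> s0 mx; have [y my /andP[ym1 y1]] := @fam_top_root 1 isT.
have y0 : 0 <= y by case: my => _; apply; exact: root_fam1_0.
have [s1|s1] := eqVneq s 1%N.
  by case: mx => _; apply => /=; rewrite s1 root_fam1_0.
apply: le_trans y0 (top_root_mono _ my mx y1 ym1).
by rewrite ltn_neqAle eq_sym s1.
Qed.

Lemma wint_fam_right s d : -1 <= d -> d < 1 ->
  sl_eigen n s * wint n (P s) d 1 = (1 - d ^+ 2) * weight n d * (P s)^`().[d].
Proof.
move=> dm1 d1; have := wint_ftc n_gt3 (P s)^`() dm1 d1 (lexx 1).
rewrite (fam_ode n_gt3 famP) wintZ // expr1n subrr !mul0r sub0r mulNr.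
by move/oppr_inj.
Qed.

(** The differential equation integrated over [d, 1] turns the tail into a boundary term in P_s'(d),
    which the root product bounds by s P_s(d) / (d - x). The factor s of the eigenvalue cancels, and
    1 - d^2 <= 1. *)
Lemma wint_fam_tail s x d : (0 < s)%N -> is_max [set t | root (P s) t] x ->
  x < d -> 0 <= d -> d < 1 ->
  (d - x) * (s%:R + n%:R - 2) * wint n (P s) d 1 <= weight n d * (P s).[d].
Proof.
move=> s0 mx xd d0 d1.
have s0' : 0 < s%:R :> R by rewrite ltr0n.
have dm1 : -1 <= d by rewrite (le_trans _ d0).
have [g0 g] := fam_deriv_right mx (ltW xd).
have E := wint_fam_right s dm1 d1.
rewrite -(ler_pM2l s0').
have -> : s%:R * ((d - x) * (s%:R + n%:R - 2) * wint n (P s) d 1) =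
          weight n d * ((1 - d ^+ 2) * ((P s)^`().[d] * (d - x))).
  transitivity ((d - x) * (sl_eigen n s * wint n (P s) d 1)).
    by rewrite /sl_eigen; ring.
  by rewrite E; ring.
rewrite [leRHS]mulrCA ler_wpM2l ?weight_ge0 //.
apply: le_trans _ g; rewrite -[leRHS]mul1r ler_wpM2r ?mulr_ge0 ?subr_ge0 ?(ltW xd) //.
by rewrite gerBl sqr_ge0.
Qed.

(** Beyond d the polynomial is at least P_s(d), so the tail is at least P_s(d) I. The upper bound on
    the tail then forces s <= w(d) / (g I). *)
Lemma root_index_set_bounded (g d : R) : 0 < g -> 0 <= d -> d < 1 ->
  exists N : nat, forall s, root_index_set P (d - g) s -> (s <= N)%N.
Proof.
move=> g0 d0 d1.
have dm1 : -1 <= d by rewrite (le_trans _ d0).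
set I := wint n 1 d 1.
have I0 : 0 < I by apply: wint_gt0 => //; [exact: oner_neq0|move=> t _; rewrite hornerC].
exists (Num.truncn (weight n d / (g * I))) => s [s1 [x mx xd]].
have xd' : x < d by rewrite (le_lt_trans xd) // gtrBl.
have Pd := fam_gt0_right mx xd'.
have T := wint_fam_tail s1 mx xd' d0 d1.
have low : (P s).[d] * I <= wint n (P s) d 1.
  rewrite -wintZ //; apply: itv_int_le; try exact: poly_weight_continuous.
  move=> t /andP[dt t1]; rewrite ler_wpM2r ?weight_ge0 // hornerZ hornerC mulr1.
  by have [] := fam_right_of_top_root mx (ltW xd') dt.
have n4 : 4 <= n%:R :> R by rewrite (ler_nat _ 4).
have h : g * I * s%:R <= weight n d.
  rewrite -(ler_pM2r Pd); apply: le_trans T.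
  have -> : g * I * s%:R * (P s).[d] = g * s%:R * ((P s).[d] * I) by ring.
  apply: ler_pM => //; first by rewrite mulr_ge0 // ltW.
    by rewrite mulr_ge0 // ltW.
  by apply: ler_pM => //; [exact: ltW|lra|lra].
by rewrite truncn_ge_nat ?divr_ge0 ?weight_ge0 ?mulr_ge0 ?(ltW g0) ?(ltW I0) //
  ler_pdivlMr ?mulr_gt0 // mulrC.
Qed.

Lemma root_index_set_max (g d : R) : 0 < g -> 0 <= d -> d < 1 ->
  root_index_set P (d - g) !=set0 ->
  exists r, is_max (root_index_set P (d - g)) r.
Proof.
move=> g0 d0 d1 [s0 Ss0].
have [N bN] := root_index_set_bounded g0 d0 d1.
have ex : exists s, `[< root_index_set P (d - g) s >] by exists s0; apply/asboolP.
have bd s : `[< root_index_set P (d - g) s >] -> (s <= N)%N by move/asboolP/bN.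
case: (ex_maxnP ex bd) => r /asboolP Sr rmax; exists r; split => // s Ss.
by rewrite leEnat; apply: rmax; apply/asboolP.
Qed.

Lemma root_index_set_down (d : R) r s : (0 < s)%N -> (s <= r)%N ->
  root_index_set P d r -> root_index_set P d s.
Proof.
move=> s0; rewrite leq_eqVlt => /orP[/eqP->//|sr] [_ [x mx xd]].
split => //; have [y my /andP[ym1 y1]] := fam_top_root s0.
by exists y => //; rewrite (le_trans (top_root_mono sr my mx y1 ym1)).
Qed.

End TopRoot.

(** * A Cauchy-Schwarz bound and a lower bound for the mass of the weight *)

Section Estimates.
Context {R : realType}.
Variable n : nat.
Hypothesis n_gt3 : (3 < n)%N.
Implicit Types (q : {poly R}) (a b d k t : R).

(** Cauchy-Schwarz through the pointwise inequality z <= z^2 / (2 N) + N / 2 with z = sqrt(w) |q|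
    and N = ||q||. Each half integrates to at most N / 2, the second because the interval has length
    at most 1. *)
Lemma itv_int_amgm q (f : R -> R) k a b :
  -1 <= a -> a <= b -> b <= 1 -> b - a <= 1 -> q != 0 -> 0 <= k ->
  {within `[a, b], continuous f} ->
  (forall t, a <= t <= b -> `|f t| <= k * (Num.sqrt (weight n t) * `|q.[t]|)) ->
  `|itv_int f a b| <= k * wnorm n q.
Proof.
move=> a1 ab b1 ba q0 k0 cf fq.
set N := wnorm n q.
have N0 : 0 < N by rewrite sqrtr_gt0 wdot_gt0.
pose u t := k / (2 * N) * ((q * q).[t] * weight n t) + k * N / 2.
have cqw : {within `[a, b], continuous (fun t => (q * q).[t] * weight n t)}.
  exact: poly_weight_continuous.
have cc (c : R) : {within `[a, b], continuous (fun=> c)}.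
  by apply: continuous_subspaceT => ?; exact: cst_continuous.
have cZ (c : R) g : {within `[a, b], continuous g} ->
   {within `[a, b], continuous (fun t => c * g t)}.
  by move=> cg; exact: within_continuousM.
have cu : {within `[a, b], continuous u}.
  by apply: within_continuousD => //; exact: cZ.
have fu t : a <= t <= b -> `|f t| <= u t.
  move=> tab; apply: le_trans (fq t tab) _.
  rewrite /u hornerM; set y := q.[t].
  rewrite -[X in _ * X + _](_ : Num.sqrt (weight n t) ^+ 2 * `|y| ^+ 2 = _); last first.
    by rewrite sqr_sqrtr ?weight_ge0 // real_normK ?num_real // mulrC expr2.
  rewrite -exprMn; set z := _ * `|y|.
  rewrite -subr_ge0.
  have -> : k / (2 * N) * z ^+ 2 + k * N / 2 - k * z = k / (2 * N) * (z - N) ^+ 2.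
    by field; rewrite gt_eqF.
  by rewrite mulr_ge0 ?sqr_ge0 // divr_ge0 // mulr_ge0 // ltW.
have uE : itv_int u a b <= k * N.
  rewrite itv_intD //; last exact: cZ.
  rewrite itv_intZ // itv_int_cst //.
  have h1 : itv_int (fun t => (q * q).[t] * weight n t) a b <= N ^+ 2.
    rewrite sqr_sqrtr; last by rewrite ltW // wdot_gt0.
    rewrite wdotE //; apply: itv_int_ge_sub => //.
      exact: poly_weight_continuous.
    by move=> t _; rewrite hornerM -expr2 mulr_ge0 ?sqr_ge0 ?weight_ge0.
  have h2 : k / (2 * N) * itv_int (fun t => (q * q).[t] * weight n t) a b <=
            k / (2 * N) * N ^+ 2.
    by rewrite ler_wpM2l // divr_ge0 // mulr_ge0 // ltW.
  have h3 : k * N / 2 * (b - a) <= k * N / 2 * 1.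
    by rewrite ler_wpM2l // divr_ge0 // mulr_ge0 // ltW.
  apply: le_trans (lerD h2 h3) _.
  by rewrite le_eqVlt; apply/predU1P; left; field; rewrite gt_eqF.
rewrite ler_norml; apply/andP; split.
  rewrite lerNl; apply: le_trans uE; rewrite -mulN1r -itv_intZ //.
  apply: itv_int_le => //; first exact: cZ.
  by move=> t tab; rewrite mulN1r; apply: le_trans (fu t tab); rewrite -normrN ler_norm.
apply: le_trans uE; apply: itv_int_le => // t tab.
by apply: le_trans (fu t tab); rewrite ler_norm.
Qed.

(** At h = 1 / (2 sqrt n), Bernoulli gives w(h) >= (1 - h^2)^n >= 1 - n h^2 = 3/4, and the weight is
    at least w(h) on [0, h]. *)
Lemma wint1_lower : 3 / 8 / Num.sqrt n%:R <= wint n 1 0 (1 / (2 * Num.sqrt n%:R)) :> R.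
Proof.
have n0 : 0 < n%:R :> R by rewrite ltr0n; lia.
set S := Num.sqrt _; have S0 : 0 < S by rewrite sqrtr_gt0.
have S2 : S ^+ 2 = n%:R by rewrite sqr_sqrtr // ltW.
set h := 1 / (2 * S); have h0 : 0 < h by rewrite divr_gt0 // mulr_gt0.
have S1 : 1 <= S by rewrite -sqrtr1 ler_sqrt // ler1n; lia.
have h1 : h <= 1 by rewrite /h ler_pdivrMr ?mulr_gt0 //; lra.
have wh : 3 / 4 <= weight n h.
  have bern (x : R) m : 0 <= x <= 1 -> 1 - m%:R * x <= (1 - x) ^+ m.
    move=> /andP[x0 x1]; elim: m => [|m IH]; first by rewrite expr0 mul0r subr0.
    have m0 : 0 <= m%:R :> R by [].
    rewrite exprS -natr1; have : (1 - x) * (1 - m%:R * x) <= (1 - x) * (1 - x) ^+ m.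
      by rewrite ler_wpM2l // subr_ge0.
    by apply: le_trans; nra.
  have hh : h ^+ 2 = 1 / (4 * n%:R).
    by rewrite -S2 /h; field; rewrite gt_eqF.
  have n4 : 4 <= n%:R :> R by rewrite (ler_nat _ 4).
  have hl : 0 < h ^+ 2 <= 1 / 2.
    by rewrite hh divr_gt0 ?mulr_gt0 //= ler_pdivrMr ?mulr_gt0 //; lra.
  rewrite /weight.
  apply: (@le_trans _ _ ((1 - h ^+ 2) `^ n%:R)); last first.
    apply: ger_powR; last by rewrite /alpha; lra.
    by case/andP: hl => ? ?; apply/andP; split; lra.
  rewrite powR_mulrn; last by case/andP: hl => ? ?; lra.
  apply: le_trans (bern _ _ _); last by case/andP: hl => ? ?; apply/andP; split; lra.
  by rewrite hh; rewrite le_eqVlt; apply/predU1P; left; field; rewrite gt_eqF.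
have -> : 3 / 8 / S = 3 / 4 * (h - 0) by rewrite /h; field; rewrite gt_eqF.
rewrite -itv_int_cst ?(ltW h0) //; apply: itv_int_le.
- by apply: continuous_subspaceT => ?; exact: cst_continuous.
- by apply: poly_weight_continuous => //; rewrite (le_trans _ (lexx 0)).
- move=> t /andP[t0 th]; rewrite hornerC mul1r; apply: le_trans wh _.
  exact: weight_nincr.
Qed.

End Estimates.

(** * The dual measure and weak duality *)

Section DualMeasure.
Context {R : realType}.
Variables (n : nat) (P : nat -> {poly R}) (d : R) (r : nat).
Hypotheses (n_gt3 : (3 < n)%N) (famP : jacobi_family n P).
Hypothesis d_lt1 : d < 1.
Hypothesis r_max : is_max (root_index_set P (d - 2 / Num.sqrt n%:R)) r.
Implicit Types (q : {poly R}) (s : nat) (t : R).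

Let S : R := Num.sqrt n%:R.
(** Chosen so that r eta = 1 / S, at most half the gap between d and the top roots of degree at most
    r; such a P_s keeps at least half of its value at d over the bump. *)
Let eta : R := 1 / (r%:R * S).

Lemma sqrt_dim_sqr : S ^+ 2 = n%:R. Proof. by rewrite sqr_sqrtr. Qed.

Lemma sqrt_dim_ge1 : 1 <= S.
Proof. by rewrite -sqrtr1 ler_sqrt ?ltr0n // ler1n; lia. Qed.

Lemma max_index_gt0 : 1 <= r%:R :> R.
Proof. by case: r_max => -[r1 _] _; rewrite ler1n. Qed.

Lemma cutoff_ge : 2 / S <= d.
Proof.
case: r_max => -[r1 [x mx xd]] _; have := top_root_ge0 n_gt3 famP r1 mx.
by move/le_trans => /(_ _ xd); rewrite subr_ge0.
Qed.

Lemma eta_bounds : 0 < eta /\ eta <= 1 / S.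
Proof.
have S0 : 0 < S := lt_le_trans ltr01 sqrt_dim_ge1.
have r1 := max_index_gt0; have r0 := lt_le_trans ltr01 r1.
rewrite /eta; split; first by rewrite divr_gt0 // mulr_gt0.
rewrite ler_pdivrMr ?mulr_gt0 // mulrA mulrAC divrK ?unitfE ?gt_eqF //.
by rewrite mul1r.
Qed.

(** The integral of q against [nu]. The bump has constant density, so its integral carries no weight
    function. *)
Definition dual_int q : R :=
  wint n q (-1) d + 2 * r%:R * weight n d * itv_int (horner q) (d - eta) d.

Lemma horner_within q (A : set R) : {within A, continuous (horner q)}.
Proof. exact/continuous_subspaceT/continuous_horner. Qed.

Lemma dual_intD p q : dual_int (p + q) = dual_int p + dual_int q.
Proof.
rewrite /dual_int wintD ?(ltW d_lt1) //.
have -> : itv_int (horner (p + q)) (d - eta) d =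
  itv_int (horner p) (d - eta) d + itv_int (horner q) (d - eta) d.
  rewrite -itv_intD; try exact: horner_within.
  by apply: eq_itv_int => t _; rewrite hornerD.
by ring.
Qed.

Lemma dual_intZ k q : dual_int (k *: q) = k * dual_int q.
Proof.
rewrite /dual_int wintZ ?(ltW d_lt1) //.
have -> : itv_int (horner (k *: q)) (d - eta) d = k * itv_int (horner q) (d - eta) d.
  rewrite -itv_intZ; last exact: horner_within.
  by apply: eq_itv_int => t _; rewrite hornerZ.
by ring.
Qed.

Lemma dual_int_ge0 q : (forall t, -1 <= t <= d -> 0 <= q.[t]) -> 0 <= dual_int q.
Proof.
move=> q0; rewrite addr_ge0 //.
  by apply: itv_int_ge0 => t td; rewrite mulr_ge0 ?q0 ?weight_ge0.
rewrite mulr_ge0 ?mulr_ge0 ?weight_ge0 //; apply: itv_int_ge0 => t /andP[t1 t2].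
rewrite q0 // t2 andbT; apply: le_trans t1.
have [_ e] := eta_bounds; have := cutoff_ge; have := sqrt_dim_ge1 => S1.
have : 0 < 1 / S by rewrite divr_gt0 //; lra.
by lra.
Qed.

(** The bump is discarded; [0, 1 / (2 S)] lies in [-1, d] because d >= 2 / S. *)
Lemma dual_int1 : 3 / 8 / S <= dual_int 1.
Proof.
have S1 := sqrt_dim_ge1; have S0 : 0 < S by lra.
have c := cutoff_ge; have i0 : 0 < S^-1 by rewrite invr_gt0.
apply: le_trans (wint1_lower n_gt3) _.
rewrite -[leLHS]addr0 lerD //; last first.
  rewrite mulr_ge0 ?mulr_ge0 ?weight_ge0 //; apply: itv_int_ge0 => t _.
  by rewrite hornerC.
apply: itv_int_ge_sub => //.
- rewrite -/S invfM; lra.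
- by apply: poly_weight_continuous => //; exact: ltW.
- by move=> t _; rewrite hornerC mul1r weight_ge0.
Qed.

(** For s > 0 the integral of [P s] over [-1, 1] against the weight is zero, so the part up to d is
    minus the tail. *)
Lemma dual_int_tailE s : (0 < s)%N ->
  dual_int (P s) = 2 * r%:R * weight n d * itv_int (horner (P s)) (d - eta) d
                   - wint n (P s) d 1.
Proof.
move=> s0; have z : wdot n (P s) 1 = 0.
  by rewrite (fam_orth_low n_gt3 famP) // size_poly1.
have c := cutoff_ge.
have i0 : 0 < S^-1 by rewrite invr_gt0 (lt_le_trans ltr01 sqrt_dim_ge1).
have d1 : -1 <= d by lra.
have := wint_split n_gt3 (P s) (lexx (-1)) d1 (ltW d_lt1) (lexx 1).
have -> : wint n (P s) (-1) 1 = 0 by rewrite -z wdotE // mulr1.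
by rewrite /dual_int => /eqP; rewrite eq_sym addr_eq0 => /eqP ->; rewrite addrC.
Qed.

(** Both sides are compared with w(d) P_s(d) / S: the tail is at most this, and the bump contributes
    at least 2 r w(d) (P_s(d) / 2) eta, which equals it. *)
Lemma dual_int_low s : (0 < s)%N -> (s <= r)%N -> 0 <= dual_int (P s).
Proof.
move=> s0 sr; rewrite dual_int_tailE // subr_ge0.
have S1 := sqrt_dim_ge1; have S0 : 0 < S by lra.
have c := cutoff_ge; have i0 : 0 < S^-1 by rewrite invr_gt0.
have [e0 e1] := eta_bounds; have r1 := max_index_gt0.
have [_ [x mx xd]] := root_index_set_down n_gt3 famP s0 sr (proj1 r_max).
rewrite -/S in xd.
have gap : 2 / S <= d - x by lra.
have xd' : x < d by lra.
have d0 : 0 <= d by lra.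
have Pd := fam_gt0_right n_gt3 famP mx xd'.
have tail := wint_fam_tail n_gt3 famP s0 mx xd' d0 d_lt1.
have w0 := weight_ge0 n d.
have sR : 1 <= s%:R :> R by rewrite ler1n.
have srR : s%:R <= r%:R :> R by rewrite ler_nat.
have I0 : 0 <= wint n (P s) d 1.
  apply: itv_int_ge0 => t /andP[dt _]; rewrite mulr_ge0 ?weight_ge0 //.
  by have [] := fam_right_of_top_root n_gt3 famP mx (le_trans (ltW xd') dt) (lexx t).
have n4 : 4 <= n%:R :> R by rewrite (ler_nat _ 4).
have S2 := sqrt_dim_sqr.
have key : S * wint n (P s) d 1 <= weight n d * (P s).[d].
  apply: le_trans tail; apply: ler_wpM2r => //.
  (* Here 2 / S bounds the gap d - x from below, and n / 2 bounds s + n - 2. *)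
  have -> : S = 2 / S * (n%:R / 2) by rewrite -S2; field; rewrite gt_eqF.
  by apply: ler_pM => //; lra.
have low : (P s).[d] / 2 * eta <= itv_int (horner (P s)) (d - eta) d.
  have -> : eta = d - (d - eta) by ring.
  rewrite -itv_int_cst; last by lra.
  have -> : d - (d - (d - eta)) = d - eta by ring.
  apply: itv_int_le; [|exact: horner_within|].
    by apply: continuous_subspaceT => ?; exact: cst_continuous.
  move=> t /andP[t1 t2]; have xt : x <= t by lra.
  have [_ _ H] := fam_right_of_top_root n_gt3 famP mx xt t2.
  have dx0 : 0 < d - x by lra.
  rewrite -(ler_pM2r dx0); apply: le_trans H.
  rewrite -!mulrA ler_pM2l //.
  have : s%:R * (d - t) <= r%:R * eta by apply: ler_pM; lra.
  have -> : r%:R * eta = 1 / S by rewrite /eta; field; rewrite !gt_eqF //; lra.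
  lra.
rewrite -(ler_pM2l S0); apply: le_trans key _.
have -> : weight n d * (P s).[d] =
   S * (2 * r%:R * weight n d * ((P s).[d] / 2 * eta)).
  by rewrite /eta; field; rewrite !gt_eqF //; lra.
by rewrite ler_pM2l // ler_wpM2l // !mulr_ge0.
Qed.

(** The weight decreases on [0, 1], so w(d) <= sqrt(w(d) w(t)) on the bump and w(t) <= sqrt(w(d)
    w(t)) on the tail. Cauchy-Schwarz bounds the two parts by 2 r and 1 times sqrt(w(d)) ||P_s||,
    and 2 r + 1 <= 3 r. *)
Lemma dual_int_high s : (0 < s)%N ->
  - (3 * r%:R * Num.sqrt (weight n d) * wnorm n (P s)) <= dual_int (P s).
Proof.
move=> s0; rewrite dual_int_tailE //.
have S1 := sqrt_dim_ge1; have S0 : 0 < S by lra.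
have c := cutoff_ge; have i0 : 0 < S^-1 by rewrite invr_gt0.
have [e0 e1] := eta_bounds; have r1 := max_index_gt0.
have i1 : S^-1 <= 1 by rewrite invf_le1.
have d0 : 0 <= d by lra.
set k := Num.sqrt _; have k0 : 0 <= k by exact: sqrtr_ge0.
have k2 : k * k = weight n d by rewrite -expr2 sqr_sqrtr ?weight_ge0.
set N := wnorm _ _.
have N0 : 0 <= N by exact: sqrtr_ge0.
have h1 : `|itv_int (fun t => weight n d * (P s).[t]) (d - eta) d| <= k * N.
  apply: itv_int_amgm => //; try lra; try exact: ltW.
  - exact: (fam_neq0 famP s).
  - apply: within_continuousM; last exact: horner_within.
    by apply: continuous_subspaceT => ?; exact: cst_continuous.
  - move=> t /andP[t1 t2]; rewrite normrM ger0_norm ?weight_ge0 // -k2 -mulrA.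
    rewrite ler_wpM2l // ler_wpM2r // ler_sqrt ?weight_ge0 //.
    by apply: weight_nincr => //; [lra|exact: ltW].
have h2 : `|wint n (P s) d 1| <= k * N.
  apply: itv_int_amgm => //; try lra; try exact: ltW.
  - exact: fam_neq0 famP _.
  - by apply: poly_weight_continuous => //; rewrite (le_trans _ d0).
  - move=> t /andP[t1 t2]; rewrite normrM mulrC ger0_norm ?weight_ge0 // mulrA.
    rewrite ler_wpM2r //.
    rewrite -{1}[weight n t](sqr_sqrtr (weight_ge0 n t)) expr2 ler_wpM2r ?sqrtr_ge0 //.
    by rewrite ler_sqrt ?weight_ge0 //; apply: weight_nincr.
rewrite itv_intZ in h1; last exact: horner_within.
have -> : 2 * r%:R * weight n d * itv_int (horner (P s)) (d - eta) d =
  2 * r%:R * (weight n d * itv_int (horner (P s)) (d - eta) d) by ring.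
have h1' : 2 * r%:R * - (k * N) <=
  2 * r%:R * (weight n d * itv_int (horner (P s)) (d - eta) d).
  rewrite ler_wpM2l ?mulr_ge0 //; move: h1; rewrite ler_norml => /andP[]. lra.
move: h2; rewrite ler_norml => /andP[_ h2].
have kN : k * N <= r%:R * (k * N) by rewrite ler_peMl // mulr_ge0.
lra.
Qed.

Lemma dual_int_fam s : (0 < s)%N ->
  - (P s).[1] <= (P r).[1] / wnorm n (P r) / (3 * r%:R * Num.sqrt (weight n d))
                 * dual_int (P s).
Proof.
move=> s0.
have r1 := max_index_gt0; have r0 : (0 < r)%N by case: r_max => -[].
have c := cutoff_ge.
have i0 : 0 < S^-1 by rewrite invr_gt0 (lt_le_trans ltr01 sqrt_dim_ge1).
have k0 : 0 < Num.sqrt (weight n d).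
  by rewrite sqrtr_gt0 weight_gt0 // d_lt1 andbT; lra.
have D0 : 0 < 3 * r%:R * Num.sqrt (weight n d).
  by rewrite !mulr_gt0 //; lra.
have v0 j := fam1_gt0 n_gt3 famP j.
have N0 j : 0 < wnorm n (P j) by rewrite sqrtr_gt0 (fam_norm_gt0 n_gt3 famP).
set D := 3 * _ * _ in D0 *.
have Q0 : 0 <= (P r).[1] / wnorm n (P r) / D.
  by rewrite !divr_ge0 // ltW.
have [sr|rs] := leqP s r.
  apply: (@le_trans _ _ 0); first by rewrite oppr_le0 ltW.
  by rewrite mulr_ge0 // dual_int_low.
(* For s > r the factor D cancels, leaving the monotonicity of P_s(1) / ||P_s||. *)
have := ler_wpM2l Q0 (dual_int_high s0); apply: le_trans.
rewrite -/D mulrN lerN2 mulrA divfK ?gt_eqF //.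
by rewrite -ler_pdivlMr // fam_ratio_le // ltnW.
Qed.

Lemma LP_feasible_lower (theta : R) (F : {poly R}) : cos theta = d ->
  LP_feasible P theta F ->
  (P r).[1] / wnorm n (P r) / (8 * r%:R * S * Num.sqrt (weight n d)) <= F.[1].
Proof.
move=> thd [m [a [FE a0 age Fle]]]; rewrite thd in Fle.
set K := (P r).[1] / wnorm n (P r) / (3 * r%:R * Num.sqrt (weight n d)).
have S1 := sqrt_dim_ge1; have r1 := max_index_gt0; have c := cutoff_ge.
have i0 : 0 < S^-1 by rewrite invr_gt0; lra.
have k0 : 0 < Num.sqrt (weight n d).
  by rewrite sqrtr_gt0 weight_gt0 // d_lt1 andbT; lra.
have v0 := fam1_gt0 n_gt3 famP r.
have N0 : 0 < wnorm n (P r) by rewrite sqrtr_gt0 (fam_norm_gt0 n_gt3 famP).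
have K0 : 0 <= K.
  by rewrite !divr_ge0 ?mulr_ge0 ?(ltW v0) ?(ltW N0) ?(ltW k0).
have P01 : P 0%N = 1.
  have /size_poly1P[c0 _ Pc] : size (P 0%N) == 1%N by rewrite (size_fam famP).
  have : (P 0%N).[1] = 1.
    by case: famP => _ _ ->; rewrite /gbinom big_ord0 fact0 divr1.
  by rewrite Pc hornerC => ->.
have F1 : F.[1] = 1 + \sum_(s < m) a s.+1 * (P s.+1).[1].
  rewrite FE horner_sum big_ord_recl /= a0 scale1r P01 hornerC; congr (_ + _).
  by apply: eq_bigr => i _; rewrite hornerZ.
have LF : dual_int F = dual_int 1 + \sum_(s < m) a s.+1 * dual_int (P s.+1).
  rewrite FE big_ord_recl /= a0 scale1r P01 dual_intD; congr (_ + _).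
  rewrite (big_morph _ dual_intD (_ : dual_int 0 = 0)); last first.
    by rewrite -(scale0r (0 : {poly R})) dual_intZ mul0r.
  by apply: eq_bigr => i _; rewrite dual_intZ.
have LF0 : dual_int F <= 0.
  rewrite -oppr_ge0 -mulN1r -dual_intZ; apply: dual_int_ge0 => t td.
  by rewrite hornerZ mulN1r oppr_ge0 Fle.
(* Since F(1) - 1 is the sum of the a_s P_s(1) over s >= 1, this bounds K times the non-constant
   part of the dual integral below by 1 - F(1). *)
have sum_ge : - \sum_(s < m) a s.+1 * (P s.+1).[1] <=
    K * \sum_(s < m) a s.+1 * dual_int (P s.+1).
  rewrite mulr_sumr -sumrN; apply: ler_sum => i _.
  rewrite mulrCA -mulrN ler_wpM2l //; first by apply: age; exact: ltn_ord.
  exact: dual_int_fam.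
have LFK : K * dual_int F <= 0 by rewrite mulr_ge0_le0.
have LK : K * (3 / 8 / S) <= K * dual_int 1 by rewrite ler_wpM2l // dual_int1.
have -> : (P r).[1] / wnorm n (P r) / (8 * r%:R * S * Num.sqrt (weight n d)) =
   K * (3 / 8 / S).
  by rewrite /K; field; rewrite !gt_eqF //; lra.
rewrite F1; move: LFK; rewrite LF mulrDr => LFK; lra.
Qed.

End DualMeasure.

(** * Passage to the infimum and comparison of exponents *)

Theorem proposition1p1 (R : realType) :
  exists2 c : R, 0 < c &
  forall (n : nat) (P : nat -> {poly R}) (theta : R),
    (7 <= n)%N ->
    jacobi_family n P ->
    0 < theta < pi ->
    let delta := cos theta in
    let S := root_index_set P (delta - 2 / Num.sqrt n%:R) in
    S !=set0 ->
    exists2 r : nat, is_max S r &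
      ((c / (r%:R * Num.sqrt n%:R)
        * (1 / (1 - delta ^+ 2)) `^ ((n%:R - 4) / 4)
        * ((P r).[1] / wnorm n (P r)))%:E <= M_LP P theta)%E.
Proof.
(* The 3 in the denominator of K cancels against the mass 3 / (8 sqrt n). *)
exists (1 / 8); first by rewrite divr_gt0.
move=> n P theta n7 famP /andP[th0 thpi] d S Sne.
have n3 : (3 < n)%N by lia.
have s0 : 0 < Num.sqrt n%:R :> R by rewrite sqrtr_gt0 ltr0n; lia.
have i0 : 0 < 2 / Num.sqrt n%:R :> R by rewrite divr_gt0.
(* Only 0 <= d < 1 remains to be treated: the nonempty index set gives a nonnegative top root below
   d. *)
have d1 : d < 1.
  by rewrite /d -cos0 ltr_cos // in_itv /= ?lexx ?pi_ge0 // !ltW.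
have d0 : 0 <= d.
  have [s [s1 [x mx xd]]] := Sne.
  have := top_root_ge0 n3 famP s1 mx; lra.
have [r rmax] := root_index_set_max n3 famP i0 d0 d1 Sne.
exists r => //; apply/ereal_infP => _ [F FP <-]; rewrite lee_fin.
apply: le_trans (LP_feasible_lower n3 famP d1 rmax (erefl d) FP).
have r1 : 1 <= r%:R :> R by case: rmax => -[r1 _] _; rewrite ler1n.
have v0 := fam1_gt0 n3 famP r.
have N0 : 0 < wnorm n (P r) by rewrite sqrtr_gt0 (fam_norm_gt0 n3 famP).
set Q := _ / wnorm n _; have Q0 : 0 < Q by rewrite divr_gt0.
have B0 : 0 < 1 - d ^+ 2 by rewrite oneB_sqr_gt0 // d1 andbT; lra.
have k0 : 0 < Num.sqrt (weight n d) by rewrite sqrtr_gt0 powR_gt0.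
have kE : (Num.sqrt (weight n d))^-1 = (1 / (1 - d ^+ 2)) `^ ((n%:R - 3) / 4).
  rewrite -powR12_sqrt ?weight_ge0 // /weight -powRrM mul1r.
  have -> : alpha n / 2 = (n%:R - 3) / 4 :> R by rewrite /alpha; field.
  move: ((n%:R - 3) / 4) => e.
  rewrite -(powR_inv1 (powR_ge0 _ e)) -(powR_inv1 (ltW B0)).
  by rewrite -!powRrM mulrC.
(* The base is at least 1, so passing from the exponent (n - 3) / 4 to (n - 4) / 4 only weakens the
   bound. *)
have pl : (1 / (1 - d ^+ 2)) `^ ((n%:R - 4) / 4) <= (Num.sqrt (weight n d))^-1.
  rewrite kE; apply: ler_powR; last by lra.
  by rewrite ler_pdivlMr // mul1r gerBl sqr_ge0.
have -> : Q / (8 * r%:R * Num.sqrt n%:R * Num.sqrt (weight n d)) =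
  1 / 8 / (r%:R * Num.sqrt n%:R) * (Num.sqrt (weight n d))^-1 * Q.
  by field; rewrite !gt_eqF //; lra.
rewrite ler_pM2r // ler_pM2l // divr_gt0 // mulr_gt0 //; lra.
Qed.
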